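(* Let $T$ be a tree of order $n$ with diameter $d(T)>3$. Then $$\lambda_1(D(P_n^c))\le \lambda_1(D(T^c))\le \lambda_1(D(T^c(n-3,1))).$$ The left equality holds if and only if $T\cong P_n$, and the right equality holds if and only if $T\cong T(n-3,1)$.
   Context: For a graph $G$, $G^c$ denotes its complement; for a connected graph $H$, $D(H)$ is its distance matrix and $\lambda_1(D(H))$ its largest eigenvalue. $P_n$ is the path on $n$ vertices. $T(n-3,1)$ is the tree obtained from the path $P_3$ by attaching $n-3$ new pendant vertices to one end vertex of $P_3$, and $T^c(n-3,1)$ is its complement. *)

(* Defs.v *)
From mathcomp Require Import all_boot all_order all_algebra.
From mathcomp Require Import spectral sesquilinear complex polyrcf.
From mathcomp Require Import boolp classical_sets reals.

Set Implicit Arguments.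
Unset Strict Implicit.
Unset Printing Implicit Defensive.

Import Order.TTheory GRing.Theory Num.Theory.

Record sgraph (n : nat) := SGraph {
  adj :> rel 'I_n;
  adj_sym : symmetric adj;
  adj_irr : irreflexive adj
}.

Definition iso (n : nat) (G H : sgraph n) : Prop :=
  exists2 f : 'I_n -> 'I_n, bijective f & forall x y, H (f x) (f y) = G x y.

Definition connected (n : nat) (G : sgraph n) : Prop :=
  forall x y, connect G x y.

(* ucycle: a closed walk without repeated vertices *)
Definition acyclic (n : nat) (G : sgraph n) : Prop :=
  forall c : seq 'I_n, 2 < size c -> ~ ucycle G c.

Definition is_tree (n : nat) (G : sgraph n) : Prop :=
  connected G /\ acyclic G.

Definition has_walk (n : nat) (G : sgraph n) (x y : 'I_n) (k : nat) : bool :=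
  [exists p : k.-tuple 'I_n, path G x p && (last x p == y)].

(* Least length of a walk from x to y; a shortest one has length < n.
   If x and y are not connected, the value is the junk n. *)
Definition dist (n : nat) (G : sgraph n) (x y : 'I_n) : nat :=
  find (has_walk G x y) (iota 0 n).

Definition diameter (n : nat) (G : sgraph n) : nat :=
  \max_(x < n) \max_(y < n) dist G x y.

Section Graphs.
Variable n : nat.

Section Complement.
Variable G : sgraph n.

Definition compl_adj : rel 'I_n := [rel x y | (x != y) && ~~ G x y].

Lemma compl_adj_sym : symmetric compl_adj.
Proof. by move=> x y; rewrite /compl_adj /= adj_sym eq_sym. Qed.

Lemma compl_adj_irr : irreflexive compl_adj.
Proof. by move=> x; rewrite /compl_adj /= eqxx. Qed.

Definition compl : sgraph n := SGraph compl_adj_sym compl_adj_irr.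
End Complement.

Definition path_adj : rel 'I_n := [rel x y : 'I_n | (x.+1 == y) || (y.+1 == x)].

Lemma path_adj_sym : symmetric path_adj.
Proof. by move=> x y; apply: orbC. Qed.

Lemma path_adj_irr : irreflexive path_adj.
Proof. by move=> x; rewrite /path_adj /= orbb eqn_leq ltnn. Qed.

Definition path_graph : sgraph n := SGraph path_adj_sym path_adj_irr.

(* T(n-3,1): the path 0 - 1 - 2, and the n - 3 pendant vertices 3, ..., n - 1
   attached to its end vertex 0.  Meaningful for n >= 3. *)
Definition broom_edge : rel nat :=
  [rel a b | [|| (a == 0) && (b == 1), (a == 1) && (b == 2)
               | (a == 0) && (3 <= b)]].

Definition broom_adj : rel 'I_n :=
  [rel x y : 'I_n | broom_edge x y || broom_edge y x].

Lemma broom_adj_sym : symmetric broom_adj.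
Proof. by move=> x y; apply: orbC. Qed.

Lemma broom_adj_irr : irreflexive broom_adj.
Proof. by case=> [[|[|[|m]]] lt_mn]. Qed.

Definition broom : sgraph n := SGraph broom_adj_sym broom_adj_irr.
End Graphs.

Local Open Scope ring_scope.
Local Open Scope classical_set_scope.

Definition distmx (R : realType) (n : nat) (G : sgraph n) : 'M[R]_n :=
  \matrix_(i, j) (dist G i j)%:R.

(* The supremum is a maximum for symmetric A and n > 0: see lambda1P. *)
Definition lambda1 (R : realType) (n : nat) (A : 'M[R]_n) : R :=
  sup [set x : R | eigenvalue A x].

Section Lambda1.
Variables (R : realType) (n : nat) (A : 'M[R]_n).

Lemma ex_eigenvalue : (0 < n)%N -> A^T = A -> exists x : R, eigenvalue A x.
Proof.
case: n A => // m M _ symM.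
set B : 'M[R[i]]_m.+1 := map_mx (@real_complex R) M.
have hermB : B \is hermsymmx.
  apply/is_hermitianmxP; rewrite expr0 scale1r; apply/matrixP => i j.
  rewrite !mxE -[in LHS]symM mxE; apply/esym/CrealP.
  by rewrite complex_real.
have /hermitian_normalmx/orthomx_spectralP eqB := hermB.
have /mxOverP/(_ 0 0) := hermitian_spectral_diag_real hermB.
set d := spectral_diag B 0 0 => /complex_realP [x dx].
exists x; rewrite eigenvalue_root_char -(fmorph_root (@real_complex R)).
rewrite map_char_poly -eigenvalue_root_char.
apply/eigenvalueP; exists (row 0 (spectralmx B)); last first.
  apply/eqP => r0.
  have := mulmxV (spectral_unit B).
  move/(congr1 (row 0)); rewrite row_mul r0 mul0mx => /rowP/(_ 0).
  by rewrite !mxE eqxx => /esym/eqP; rewrite oner_eq0.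
rewrite -/B -row_mul {2}eqB !mulmxA mulmxV ?spectral_unit // mul1mx.
by rewrite row_mul row_diag_mx -/d dx -scalemxAl -rowE.
Qed.

Lemma lambda1P : (0 < n)%N -> A^T = A ->
  eigenvalue A (lambda1 A) /\ forall x, eigenvalue A x -> x <= lambda1 A.
Proof.
move=> n_gt0 symA; have [x0 ex0] := ex_eigenvalue n_gt0 symA.
have p_neq0 : char_poly A != 0 by rewrite monic_neq0 ?char_poly_monic.
have rE x : (x \in rootsR (char_poly A)) = eigenvalue A x.
  by rewrite eigenvalue_root_char -roots_on_rootsR // inE.
set m := \big[Num.max/x0]_(x <- rootsR (char_poly A)) x.
have em : eigenvalue A m.
  rewrite /m big_seq; apply: (big_ind (eigenvalue A)) => // [x y ex ey|x].
    by rewrite maxEle; case: ifP.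
  by rewrite rE.
have ubm x : eigenvalue A x -> x <= m.
  by rewrite -rE => rx; apply: (@le_bigmax_seq _ _ _ _ _ x xpredT id).
suff -> : lambda1 A = m by [].
apply/le_anti/andP; split; first by apply: ge_sup; [exists m | exact: ubm].
by apply: ub_le_sup => //; exists m; exact: ubm.
Qed.
End Lambda1.

(* Main.v *)
From HB Require Import structures.
Require Import Defs.
From mathcomp Require Import all_boot all_order all_algebra.
From mathcomp Require Import fingroup perm spectral sesquilinear complex.
From mathcomp Require Import boolp reals zify ring lra.

Set Implicit Arguments.
Unset Strict Implicit.
Unset Printing Implicit Defensive.

Import Order.TTheory GRing.Theory Num.Theory.

(** If [T] has diameter greater than 3, no edge of [T] is dominating, so that
    [D(T^c) = J - I + A(T)], whose quadratic form is
    [(sum x)^2 - |x|^2 + 2 sum_(uv edge) x_u x_v].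

    Lower bound.  List the path from its centre outwards: the [k]-th vertex is
    then joined to the [k.-2]-th, and the Perron vector of the path is
    nonincreasing along this list.  Peeling off leaves lists the vertices of any
    tree [T] so that the [k]-th vertex is joined to a single earlier one, of
    index at most [k.-2].  Moving the Perron vector of the path to [T] along these
    lists can only increase the edge sum.  In case of equality it is an
    eigenvector for [T] as well, which forces the parents to be [k.-2].

    Upper bound.  Root [T] at a maximal entry [x_r] of its Perron vector: the edge
    sum is at most [x_r (sum x - x_r)].  The broom, of diameter 3, has a dominating
    edge whose ends are at distance 3 in the complement, and this extra weight
    makes its form strictly larger.  Hence the right equality never holds, and
    neither does the isomorphism. *)

(** * Distances in complements *)

Section Walks.
Variables (n : nat) (G : sgraph n).
Implicit Types x y z u v w : 'I_n.

(** Bounding the length, instead of fixing it as [has_walk] does, lets a pause at a vertex count as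
    a step. *)
Definition reach_in x y k : Prop :=
  exists p, [/\ path G x p, last x p = y & size p <= k].

Lemma reach_in_trans y x z k l :
  reach_in x y k -> reach_in y z l -> reach_in x z (k + l).
Proof.
move=> [p [Gp lp sp]] [q [Gq lq sq]]; exists (p ++ q).
by rewrite cat_path last_cat Gp lp Gq lq size_cat leq_add.
Qed.

Lemma reach_in1 x y : (x == y) || G x y -> reach_in x y 1.
Proof.
case/orP => [/eqP <-|Gxy]; first by exists [::].
by exists [:: y]; rewrite /= Gxy.
Qed.

Lemma dist_le_size x y : dist G x y <= n.
Proof. by rewrite /dist -[leqRHS](size_iota 0) find_size. Qed.

Lemma has_walkP x y k :
  reflect (exists p, [/\ path G x p, last x p = y & size p = k])
          (has_walk G x y k).
Proof.
apply: (iffP existsP) => [[p /andP[Gp /eqP lp]]|[p [Gp lp /eqP sp]]].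
  by exists p; rewrite size_tuple.
by exists (Tuple sp); rewrite /= Gp lp eqxx.
Qed.

Lemma dist_le x y k : has_walk G x y k -> dist G x y <= k.
Proof.
move=> wk; have [kn|nk] := ltnP k n; last exact: leq_trans (dist_le_size x y) nk.
rewrite leqNgt; apply/negP => /(before_find 0).
by rewrite nth_iota // add0n wk.
Qed.

Lemma dist_reach x y k : reach_in x y k -> dist G x y <= k.
Proof.
move=> [p [Gp lp sp]]; apply: leq_trans sp; apply: dist_le.
by apply/has_walkP; exists p.
Qed.

(** The condition [k <= n] reflects that [dist] is capped at its default value [n]. *)
Lemma dist_ge x y k :
  k <= n -> (forall j, j < k -> ~~ has_walk G x y j) -> k <= dist G x y.
Proof.
move=> kn nw; rewrite leqNgt; apply/negP => dk.
have dn : dist G x y < n by apply: leq_trans kn.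
have : has (has_walk G x y) (iota 0 n) by rewrite has_find size_iota.
move/(nth_find 0); rewrite -/(dist G x y) nth_iota // add0n.
by rewrite (negPf (nw _ dk)).
Qed.

Lemma has_walk0 x y : has_walk G x y 0 = (x == y).
Proof.
apply/has_walkP/eqP => [[[|? ?] [_ /= l s]]|->] //.
by exists [::].
Qed.

Lemma has_walk1 x y : has_walk G x y 1 = G x y.
Proof.
apply/has_walkP/idP => [[[|z [|? ?]] [//= /andP[Gxz _] <- //]]|Gxy].
by exists [:: y]; rewrite /= Gxy.
Qed.

Lemma has_walk2 x y : has_walk G x y 2 = [exists w, G x w && G w y].
Proof.
apply/has_walkP/existsP => [|[w /andP[a b]]].
  by case=> -[|z [|t [|? ?]]] [//= /and3P[a b _] <- _]; exists z; rewrite a.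
by exists [:: w; y]; rewrite /= a b.
Qed.

Lemma dist_connected x y : connected G -> dist G x y < n.
Proof.
move=> /(_ x y)/connectP[p Gp ->]; case/shortenP: Gp => q Gq uq _.
have sq : size q < n.
  by have /card_uniqP/= <- := uq; rewrite (leq_trans (max_card _)) ?card_ord.
apply: leq_ltn_trans sq; apply: dist_reach; by exists q.
Qed.

Lemma diameter_lt_order k : connected G -> k < diameter G -> k.+1 < n.
Proof.
move=> cG; apply: contraTltn => nk; rewrite -leqNgt.
apply/bigmax_leqP => x _; apply/bigmax_leqP => y _.
by have := dist_connected x y cG; lia.
Qed.

(** The witness [w] is a common neighbour of [u] and [v] in the complement, which puts them at
    distance 2 there. *)
Definition undominated : Prop :=
  forall u v, G u v -> exists w, [&& w != u, w != v, ~~ G u w & ~~ G v w].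

(** If the edge [uv] dominated every vertex, any two vertices would be joined in at most three
    steps, the middle one staying within [u] and [v]. *)
Lemma diameter_undominated : 3 < diameter G -> undominated.
Proof.
move=> dG u v Guv; apply/existsP; apply: contraTT dG => /existsPn nd.
have dom a : (a == u) || G a u \/ (a == v) || G a v.
  apply/orP; have := nd a; rewrite !(adj_sym G _ a).
  by case: (a == u); case: (a == v); case: (G a u); case: (G a v).
have from a : reach_in a u 1 \/ reach_in a v 1.
  by case: (dom a) => h; [left|right]; apply: reach_in1.
have to a : reach_in u a 1 \/ reach_in v a 1.
  by case: (dom a) => h; [left|right]; apply: reach_in1; rewrite eq_sym adj_sym.
have ruv : reach_in u v 1 by apply: reach_in1; rewrite Guv orbT.
have rvu : reach_in v u 1 by apply: reach_in1; rewrite adj_sym Guv orbT.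
have loop a : reach_in a a 1 by apply: reach_in1; rewrite eqxx.
rewrite -leqNgt; apply/bigmax_leqP => x _; apply/bigmax_leqP => y _.
apply: dist_reach; rewrite -[3]/(1 + 1 + 1).
case: (from x) (to y) => hx [] hy.
- exact: reach_in_trans (reach_in_trans hx (loop u)) hy.
- exact: reach_in_trans (reach_in_trans hx ruv) hy.
- exact: reach_in_trans (reach_in_trans hx rvu) hy.
- exact: reach_in_trans (reach_in_trans hx (loop v)) hy.
Qed.

End Walks.

Lemma dist_compl_ge n (G : sgraph n) (x y : 'I_n) : 1 < n ->
  (x != y) + G x y <= dist (compl G) x y.
Proof.
move=> n1; case: (eqVneq x y) => [->|nxy]; first by rewrite adj_irr.
case Gxy: (G x y).
  apply: dist_ge => // -[|[|//]] _; rewrite ?has_walk0 ?has_walk1 //.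
  by rewrite /= /compl_adj /= Gxy andbF.
by apply: dist_ge => [|[|//] _]; rewrite ?has_walk0 //; apply: ltnW.
Qed.

Lemma dist_compl n (G : sgraph n) (x y : 'I_n) : 1 < n ->
  undominated G -> dist (compl G) x y = (x != y) + G x y.
Proof.
move=> n1 und; apply/eqP; rewrite eqn_leq dist_compl_ge // andbT.
case: (eqVneq x y) => [<-|nxy].
  by rewrite adj_irr; apply: dist_le; rewrite has_walk0.
case Gxy: (G x y); last first.
  by apply: dist_le; rewrite has_walk1 /= /compl_adj /= nxy Gxy.
apply: dist_le; rewrite has_walk2; apply/existsP.
have [w /and4P[wx wy gx gy]] := und _ _ Gxy; exists w.
by rewrite /= /compl_adj /= eq_sym wx gx wy adj_sym gy.
Qed.

Lemma path_undominated n : 4 < n -> undominated (path_graph n).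
Proof.
move=> n5; have n0 : 0 < n by lia.
have nn : n.-1 < n by lia.
move=> u v; rewrite /= /path_adj /= => uv.
(* If both ends of the edge exceed 1, vertex 0 is far from it; otherwise both are at most 2, and the
   last vertex, at least 4, is. *)
have [h|h] := ltnP 1 (minn u v).
  exists (Ordinal n0); rewrite /path_adj /= -!val_eqE /=; lia.
exists (Ordinal nn); rewrite /path_adj /= -!val_eqE /=; lia.
Qed.

(** The edge between 0 and 1 dominates the broom, so these vertices have no common neighbour in the
    complement. A lower bound is enough, because the eigenvalue of the broom is only estimated from
    below. *)
Lemma dist_broom_compl n (x y : 'I_n) : 4 < n ->
  (x != y) + broom n x y + ((x < 2) && (y < 2) && (x != y))
    <= dist (compl (broom n)) x y.
Proof.
move=> n5; case: (boolP (_ && _)) => [/andP[/andP[x2 y2] nxy]|_]; last first.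
  by rewrite addn0 dist_compl_ge //; lia.
apply: (@leq_trans 3).
  by rewrite nxy; case: (broom n x y).
move: nxy; rewrite -val_eqE /= => nxy.
apply: dist_ge; first by lia.
case=> [|[|[|//]]] _; rewrite ?has_walk0 ?has_walk1 ?has_walk2.
- by rewrite -val_eqE.
- by rewrite /= /compl_adj /= /broom_adj /broom_edge /= -!val_eqE /=; lia.
- case: x y x2 y2 nxy => [[|[|//]] ix] [[|[|//]] iy] // _ _ _;
    by apply/existsPn => -[[|[|[|w]]] iw];
    rewrite /= /compl_adj /= /broom_adj /broom_edge /= -?val_eqE ?andbF.
Qed.

Lemma broom_dominated n : 4 < n -> ~ undominated (broom n).
Proof.
move=> n5; have n0 : 0 < n by lia.
have n1 : 1 < n by lia.
case/(_ (Ordinal n0) (Ordinal n1)) => // w.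
by rewrite /= /broom_adj /broom_edge /= -!val_eqE /=; lia.
Qed.

Lemma undominated_iso n (G H : sgraph n) : iso G H -> undominated G -> undominated H.
Proof.
move=> [f [g fK gK] fG] und u v; rewrite -(gK u) -(gK v) fG => /und[w].
have inj := can_inj fK.
by exists (f w); rewrite !fG !(inj_eq inj).
Qed.

Lemma has_walk_sym n (G : sgraph n) x y k : has_walk G x y k = has_walk G y x k.
Proof.
have half u v : has_walk G u v k -> has_walk G v u k.
  move=> /has_walkP[p [Gp lp sp]]; apply/has_walkP; exists (rev (belast u p)).
  rewrite size_rev size_belast -lp rev_path; split=> //.
    by rewrite (eq_path (e' := G)) // => a b; rewrite /= adj_sym.
  by case: (p) => //= a q; rewrite rev_cons last_rcons.
by apply/idP/idP; apply: half.
Qed.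

Lemma dist_sym n (G : sgraph n) x y : dist G x y = dist G y x.
Proof. by apply: eq_find => k; apply: has_walk_sym. Qed.

(** * Orderings of trees *)

Section Peeling.
Variables (n : nat) (G : sgraph n).
Implicit Types (W U : {set 'I_n}) (a b r u v w : 'I_n) (s : seq 'I_n).

(** Connectedness of the subgraph induced on [W], expressed by cuts so that no graph on a smaller
    vertex type is needed. *)
Definition linked W : Prop := forall U, U != set0 -> U \proper W ->
  exists u v, [/\ u \in U, v \in W, v \notin U & G u v].

Definition leaf W a b : Prop :=
  [/\ a \in W, b \in W & forall w, w \in W -> G a w = (w == b)].

Lemma leaf_neq W a b : leaf W a b -> b != a.
Proof.
by case=> _ bW lf; apply/eqP => e; have := lf b bW; rewrite eqxx e adj_irr.
Qed.

Lemma connected_linked : connected G -> linked setT.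
Proof.
move=> cG U /set0Pn[x xU] /properP[_ [y _ yU]].
case: (boolP [exists u, exists v, [&& u \in U, v \notin U & G u v]]).
  by move=> /existsP[u /existsP[v /and3P[]]]; exists u, v; rewrite inE.
move=> /existsPn nc; exfalso.
have cross u v : G u v -> u \in U -> v \in U.
  move=> Guv uU; have /existsPn/(_ v) := nc u.
  by rewrite uU Guv andbT /= negbK.
have cl : fingraph.closed G (mem U).
  move=> u v Guv; apply/idP/idP; first exact: cross.
  by apply: cross; rewrite adj_sym.
by have := closed_connect cl (cG x y); rewrite /= xU (negPf yU).
Qed.

Lemma linked_leaf W a b : linked W -> leaf W a b -> linked (W :\ a).
Proof.
move=> lW lf U U0 UW; have [aW bW aG] := lf.
have UaW : U \subset W :\ a by apply: proper_sub.
have aU : a \notin U by apply/negP => /(subsetP UaW); rewrite !inE eqxx.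
have UsW : U \subset W by apply: subset_trans UaW (subsetDl _ _).
(* If [b] is in [U], the cut [a |: U] of [W] has an edge that cannot start at [a]; otherwise the cut
   [U] of [W] has an edge that cannot end at [a]. *)
have [bU|bU] := boolP (b \in U).
  have [||u [v [uU vW vU Guv]]] := lW (a |: U).
  - by apply/set0Pn; exists a; rewrite !inE eqxx.
  - have /properP[_ [y]] := UW; rewrite !inE => /andP[ya yW] yU.
    apply/properP; split; first by rewrite subUset sub1set aW.
    by exists y => //; rewrite !inE negb_or ya.
  move: uU vU; rewrite !inE negb_or => uU /andP[va vU].
  exists u, v; split=> //.
  + case/orP: uU => // /eqP ua; move: Guv; rewrite ua aG // => /eqP vb.
    by move: vU; rewrite vb bU.
  + by rewrite !inE va.
have [||u [v [uU vW vU Guv]]] := lW U => //.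
  by apply/properP; split=> //; exists a.
exists u, v; split=> //; rewrite !inE vW andbT; apply/eqP => va.
move: Guv; rewrite va adj_sym aG ?(subsetP UsW) // => /eqP ub.
by move: uU; rewrite ub (negPf bU).
Qed.

(* The end of a longest simple path starting at [r] is a leaf. *)
Lemma exists_leaf W r : acyclic G -> linked W -> r \in W -> 1 < #|W| ->
  exists a b, leaf W a b /\ a != r.
Proof.
move=> acG lW rW W2.
pose good p := [&& path G r p, uniq (r :: p) & all [in W] (r :: p)].
pose P k := [exists p : k.-tuple 'I_n, good p].
have exP : exists k, P k.
  by exists 0; apply/existsP; exists [tuple]; rewrite /good /= rW.
have ubP k : P k -> k <= n.
  case/existsP => p /and3P[_ up _]; rewrite -(size_tuple p).
  have /card_uniqP/= e := up; have := max_card [in r :: p].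
  by rewrite e card_ord => /ltnW.
case: (ex_maxnP exP ubP) => k /existsP[p gp] maxk.
have maxp q : good q -> size q <= size p.
  move=> gq; rewrite size_tuple; apply: maxk.
  by apply/existsP; exists (in_tuple q).
have [w [w1 w2 w3]] : exists w, [/\ w \in W, w != r & G r w].
  have [||u [v []]] := lW [set r].
  - by apply/set0Pn; exists r; rewrite inE.
  - by rewrite properEcard sub1set rW cards1.
  by rewrite !inE => /eqP -> vW vr Gv; exists v.
have p0 : 0 < size p.
  apply: (maxp [:: w]); rewrite /good /= w3 rW w1 !inE eq_sym w2.
  by [].
move: (tval p) gp maxp p0 => {k p maxk} p gp maxp p0.
case/lastP: p gp maxp p0 => [//|p a] gp maxp _.
move: gp; rewrite /good rcons_path -rcons_cons rcons_uniq all_rcons.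
move=> /and3P[/andP[Gp Gba] /andP[ap up] /andP[aW pW]].
exists a, (last r p); split; last first.
  by apply: contra ap => /eqP ->; rewrite inE eqxx.
split=> // [|v vW]; first by apply: (allP pW); apply: mem_last.
apply/idP/eqP => [Gav|->]; last by rewrite adj_sym.
have va : v != a by apply: contraTneq Gav => ->; rewrite adj_irr.
have vp : v \in r :: p.
  apply/negPn/negP => vp; have := maxp (rcons (rcons p a) v).
  rewrite !size_rcons ltnn => h; suff: false by []; apply: h.
  rewrite /good !rcons_path last_rcons Gp Gba Gav -!rcons_cons !rcons_uniq.
  by rewrite !all_rcons vW aW pW mem_rcons inE negb_or va vp ap up.
apply/eqP/negPn/negP => nvb.
(* A neighbour [v] of [a] on the path, other than the vertex just before [a], would close the
   stretch from [v] to [a] into a cycle. *)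
case/splitPl: vp Gp Gba ap up nvb {maxp pW} => p1 p2 lp1.
rewrite last_cat cat_path lp1 => /andP[_ Gp2] Gba.
rewrite -cat_cons mem_cat negb_or cat_uniq => /andP[_ ap2] /and3P[_ hp2 up2] nvb.
have vp2 : v \notin p2.
  by apply: contra hp2 => vp2; apply/hasP; exists v => //=; rewrite -lp1 mem_last.
apply: (acG (v :: rcons p2 a)).
  by rewrite /= size_rcons; case: (p2) nvb => //=; rewrite eqxx.
rewrite /ucycle /ucycleb /= !rcons_path last_rcons Gp2 Gba Gav mem_rcons inE.
by rewrite negb_or va vp2 rcons_uniq ap2 up2.
Qed.

(** The function [f] bounds the position of the parent: [predn] only says that it comes earlier,
    [j.-2] serves the comparison with the path. *)
Definition peeled (f : nat -> nat) r s : Prop :=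
  forall j, 0 < j < size s -> exists2 i, i <= f j &
    forall k, k < j -> G (nth r s k) (nth r s j) = (k == i).

Lemma peeled_rcons f r s a b : peeled f r s -> uniq s -> b \in s ->
  (forall w, w \in s -> G a w = (w == b)) -> index b s <= f (size s) ->
  peeled f r (rcons s a).
Proof.
move=> ps us bs aG fb j; rewrite size_rcons ltnS => /andP[j0 js].
have [jlt|jge] := ltnP j (size s).
  have [|i fi iP] := ps j; first by rewrite j0.
  exists i => // k kj; rewrite !nth_rcons jlt (ltn_trans kj jlt).
  exact: iP.
have -> : j = size s by apply/eqP; rewrite eqn_leq js.
exists (index b s) => // k ks.
rewrite !nth_rcons ks ltnn eqxx adj_sym aG ?mem_nth //.
by rewrite -[X in _ == X](nth_index r bs) nth_uniq // index_mem.
Qed.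

(** Every removed leaf differs from [r], so [r] survives to the end and heads the list. *)
Lemma peel_root W r : acyclic G -> linked W -> r \in W ->
  exists s, [/\ uniq s, s =i W, nth r s 0 = r & peeled predn r s].
Proof.
move=> acG; have [m] := ubnP #|W|; elim: m W => // m IH W Wm lW rW.
have [W1|W2] := leqP #|W| 1.
  exists [:: r]; split=> // [w|[|[|//]] //].
  suff -> : W = [set r] by rewrite !inE.
  by apply/esym/eqP; rewrite eqEcard sub1set rW cards1.
have [a [b [lf ar]]] := exists_leaf acG lW rW W2.
have [aW bW aG] := lf; have ba := leaf_neq lf.
have [|||s [us sW s0 ps]] := IH (W :\ a).
- by move: Wm; rewrite (cardsD1 a) aW.
- exact: linked_leaf lf.
- by rewrite !inE eq_sym ar.
have bs : b \in s by rewrite sW !inE ba.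
have ib : index b s < size s by rewrite index_mem.
have ss : 0 < size s by apply: leq_trans ib.
exists (rcons s a); split.
- by rewrite rcons_uniq us sW !inE eqxx.
- move=> w; rewrite mem_rcons inE sW !inE.
  by case: eqP => // ->; rewrite aW.
- by rewrite nth_rcons ss.
- apply: (peeled_rcons ps us bs) => [w|].
    by rewrite sW !inE => /andP[_ /aG].
  by case: (size s) ib.
Qed.

(* The leaf to be placed just before [a] is chosen different from the
   neighbour [b] of [a]. *)
Lemma peel_leaf W r a b : acyclic G -> linked W -> leaf W a b ->
  exists s, [/\ uniq (rcons s a), rcons s a =i W &
    peeled (fun j => j.-2) r (rcons s a)].
Proof.
move=> acG; have [m] := ubnP #|W|; elim: m W a b => // m IH W a b Wm lW lf.
have [aW bW aG] := lf; have ba := leaf_neq lf.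
have lW' := linked_leaf lW lf; have bW' : b \in W :\ a by rewrite !inE ba.
suff [s [us sW ps bs]] : exists s, [/\ uniq s, s =i W :\ a,
    peeled (fun j => j.-2) r s & index b s <= (size s).-2].
  exists s; split.
  - by rewrite rcons_uniq us sW !inE eqxx.
  - move=> w; rewrite mem_rcons inE sW !inE.
    by case: eqP => // ->; rewrite aW.
  - apply: (peeled_rcons (b := b) ps us) => // [|w]; first by rewrite sW.
    by rewrite sW !inE => /andP[_ /aG].
have [W1|W2] := leqP #|W :\ a| 1.
  exists [:: b]; split=> // [w|[|[|//]] //|]; last by rewrite /= eqxx.
  suff -> : W :\ a = [set b] by rewrite !inE.
  by apply/esym/eqP; rewrite eqEcard sub1set bW' cards1.
have [a' [b' [lf' ab']]] := exists_leaf acG lW' bW' W2.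
have [|s [us sW ps]] := IH _ _ _ _ lW' lf'.
  by move: Wm; rewrite (cardsD1 a) aW.
exists (rcons s a'); split=> //.
(* As [b] is not the last element [a'], its position is at most the length minus 2. *)
have : b \in rcons s a' by rewrite sW.
rewrite mem_rcons inE eq_sym (negPf ab') /= => bs.
by move: (bs); rewrite -index_mem -cats1 index_cat bs size_cat /=; lia.
Qed.

End Peeling.

Section Layout.
Variables (n : nat) (G : sgraph n).

(* The vertices are enumerated as [s 0, ..., s n.-1], and the only neighbour of
   [s j] among its predecessors is [s (p j)]; values beyond [n] are irrelevant. *)
Definition layout (s : nat -> 'I_n) (p : nat -> nat) : Prop :=
  [/\ {in gtn n &, injective s}, forall j, 0 < j < n -> p j < j &
    forall i j, i < j -> j < n -> G (s i) (s j) = (i == p j)].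

Lemma peeled_layout f r (l : seq 'I_n) :
  (forall j, 0 < j -> f j < j) -> uniq l -> l =i setT -> peeled G f r l ->
  exists2 p, layout (nth r l) p & forall j, 0 < j < n -> p j <= f j.
Proof.
move=> fj ul lT pl.
have sl : size l = n.
  have /card_uniqP <- := ul; rewrite -[RHS]card_ord -cardsT.
  exact: eq_card.
have /choice[p pP] : forall j, exists i, 0 < j < n -> i <= f j /\
    forall k, k < j -> G (nth r l k) (nth r l j) = (k == i).
  move=> j; have [jn|jn] := boolP (0 < j < n); last by exists 0.
  by have [|i ifj iP] := pl j; [rewrite sl | exists i].
exists p => [|j /pP[]//]; split.
- move=> i j; rewrite !inE => ni nj /eqP; rewrite nth_uniq ?sl //.
  by move/eqP.
- by move=> j jn; have [h _] := pP j jn; have := fj j; lia.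
- move=> i j ij jn; have [|_] := pP j; first lia.
  by apply.
Qed.

Lemma tree_layout_root r : is_tree G ->
  exists s p, layout s p /\ s 0 = r.
Proof.
move=> [cG aG].
have [l [ul lT l0 pl]] := peel_root aG (connected_linked cG) (in_setT r).
have [|p lp _] := peeled_layout _ ul lT pl; first by case.
by exists (nth r l), p.
Qed.

Lemma tree_layout_spread : 1 < n -> is_tree G ->
  exists s p, layout s p /\ forall j, 0 < j < n -> p j <= j.-2.
Proof.
move=> n1 [cG aG]; have lT := connected_linked cG.
pose r := Ordinal (ltnW n1).
have [||a [b [lf _]]] := exists_leaf (r := r) aG lT; rewrite ?inE //.
  by rewrite cardsT card_ord.
have [l [ul lE pl]] := peel_leaf r aG lT lf.
have [|p lp pf] := peeled_layout _ ul lE pl; first by case=> // -[].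
by exists (nth r (rcons l a)), p.
Qed.

Lemma layout_inv s p : layout s p -> exists t : 'I_n -> nat,
  [/\ forall v, t v < n, cancel t s & forall k, k < n -> t (s k) = k].
Proof.
case=> inj _ _; pose f (k : 'I_n) := s k.
have fI : injective f.
  by move=> i j /inj e; apply/val_inj/e; rewrite inE ltn_ord.
have [g fK gK] := injF_bij fI.
exists (fun v => nat_of_ord (g v)); split=> // k kn.
by have := fK (Ordinal kn); rewrite /f /= => ->.
Qed.

Definition parent_adj (p : nat -> nat) (i j : nat) : bool :=
  if i < j then i == p j else (j < i) && (j == p i).

Lemma layout_adj s p i j : layout s p -> i < n -> j < n ->
  G (s i) (s j) = parent_adj p i j.
Proof.
move=> [_ _ ls] ni nj; rewrite /parent_adj; case: ltngtP => [ij|ji|<-] /=.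
- exact: ls.
- by rewrite adj_sym ls.
- by rewrite adj_irr.
Qed.

End Layout.

Lemma layout_iso n (G H : sgraph n) s t p q : layout G s p -> layout H t q ->
  (forall j, 0 < j < n -> q j = p j) -> iso G H.
Proof.
move=> ls lt qp; have [s' [s'n s'K sK]] := layout_inv ls.
have [t' [t'n t'K tK]] := layout_inv lt.
exists (fun v => t (s' v)).
  by exists (fun v => s (t' v)) => v; rewrite ?tK ?sK.
move=> x y; rewrite (layout_adj lt) // -{2}(s'K x) -{2}(s'K y) (layout_adj ls) //.
have [xn yn] := (s'n x, s'n y); rewrite /parent_adj.
by case: ltngtP => //= h; rewrite qp //; lia.
Qed.

Lemma path_layout n : 0 < n -> exists s, layout (path_graph n) s (fun j => j.-2).
Proof.
(* Starting at the centre [n./2], odd positions go left and even ones right. *)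
move=> n0; pose c k := if odd k then n./2 - k.+1./2 else n./2 + k./2.
have cn k : k < n -> c k < n by rewrite /c; case: ifP; lia.
exists (fun k => insubd (Ordinal n0) (c k)).
have val_s k : k < n -> val (insubd (Ordinal n0) (c k)) = c k.
  by move=> /cn ck; rewrite val_insubd ck.
split=> [i j|j|i j ij jn].
- rewrite !inE => ni nj /(congr1 val); rewrite !val_s // /c.
  by case: ifP; case: ifP; lia.
- by lia.
- have ni : i < n by apply: ltn_trans jn.
  rewrite /= /path_adj /=.
  have -> := val_s i ni; have -> := val_s j jn.
  by rewrite /c; case: ifP; case: ifP; lia.
Qed.

(** The boolean [j == 2] is read as a number: the parent of 2 is 1, that of every other later vertex
    is 0. *)
Lemma broom_layout n (n0 : 0 < n) :
  layout (broom n) (insubd (Ordinal n0)) (fun j => j == 2).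
Proof.
have val_s k : k < n -> val (insubd (Ordinal n0) k) = k.
  by move=> kn; rewrite val_insubd kn.
split=> [i j|j|i j ij jn].
- by rewrite !inE => ni nj /(congr1 val); rewrite !val_s.
- by case: j => [|[|[|]]].
- have ni : i < n by apply: ltn_trans jn.
  rewrite /= /broom_adj /broom_edge /=.
  have -> := val_s i ni; have -> := val_s j jn.
  by case: i j ij {jn ni} => [|[|[|i]]] [|[|[|j]]].
Qed.

(** * Rayleigh quotients *)

Local Open Scope ring_scope.
Local Open Scope sesquilinear_scope.

Lemma sum_neq (R : pzRingType) n (x : 'I_n -> R) i :
  \sum_j (i != j)%:R * x j = \sum_j x j - x i.
Proof.
rewrite [in RHS](bigD1 i) //= (bigD1 i) //= eqxx mul0r add0r.
rewrite [x i + _]addrC addrK; apply: eq_bigr => j.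
by rewrite eq_sym => ->; rewrite mul1r.
Qed.

Section Rayleigh.
Variables (R : realType) (n : nat).
Local Notation toC := (@real_complex R).
Implicit Types (A : 'M[R]_n) (x y : 'I_n -> R).

Definition qform A x : R := \sum_i \sum_j A i j * x i * x j.

(** By the spectral theorem over [R[i]], the form is a sum of eigenvalues times squared moduli of
    coordinates in a unitary eigenbasis. These eigenvalues are real and are roots of the
    characteristic polynomial of [A]. *)
Lemma rayleigh A x : (0 < n)%N -> A^T = A ->
  qform A x <= lambda1 A * \sum_i x i ^+ 2.
Proof.
move=> n0 symA; have [_ lub] := lambda1P n0 symA.
pose B := map_mx toC A.
have hermB : B \is hermsymmx.
  apply/is_hermitianmxP; rewrite expr0 scale1r; apply/matrixP => i j.
  rewrite !mxE -[in LHS]symA mxE; apply/esym/CrealP.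
  by rewrite complex_real.
have /hermitian_normalmx/orthomx_spectralP eqB := hermB.
set U := spectralmx B in eqB; set d := spectral_diag B in eqB.
have unU : U \is unitarymx by apply: spectral_unitarymx.
have dle k : d 0 k <= toC (lambda1 A).
  have /mxOverP/(_ 0 k) := hermitian_spectral_diag_real hermB.
  rewrite -/d => /complex_realP [c dc]; rewrite dc lecR; apply: lub.
  rewrite eigenvalue_root_char -(fmorph_root toC).
  rewrite map_char_poly -eigenvalue_root_char.
  apply/eigenvalueP; exists (row k U); last first.
    apply/eqP => r0.
    have := mulmxV (spectral_unit B); rewrite -/U.
    move/(congr1 (row k)); rewrite row_mul r0 mul0mx => /rowP/(_ k).
    by rewrite !mxE eqxx => /esym/eqP; rewrite oner_eq0.
  rewrite -/B -row_mul eqB !mulmxA mulmxV ?spectral_unit // mul1mx.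
  by rewrite row_mul row_diag_mx dc -scalemxAl -rowE.
pose xc : 'rV[R[i]]_n := \row_i toC (x i).
have xcT : xc ^t* = xc^T.
  by apply/matrixP => i j; rewrite !mxE; apply/CrealP; rewrite complex_real.
pose w := xc *m U ^t*.
have wT : w ^t* = U *m xc^T.
  by rewrite /w trmx_mul map_mxM /= xcT trmxCK.
have qE : toC (qform A x) = \sum_k d 0 k * `|w 0 k| ^+ 2.
  transitivity ((xc *m B *m xc^T) 0 0).
    rewrite /qform exchange_big rmorph_sum /= mxE; apply: eq_bigr => j _.
    rewrite !mxE mulr_suml rmorph_sum; apply: eq_bigr => i _.
    by rewrite !mxE !rmorphM /= [toC (A i j) * _]mulrC.
  rewrite eqB invmx_unitary // !mulmxA -/w -mulmxA -wT mxE.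
  apply: eq_bigr => k _; rewrite mul_mx_diag !mxE normCK.
  by rewrite mulrCA mulrA.
have nE : toC (\sum_i x i ^+ 2) = \sum_k `|w 0 k| ^+ 2.
  transitivity ((w *m w ^t*) 0 0); last first.
    by rewrite mxE; apply: eq_bigr => k _; rewrite !mxE normCK.
  rewrite wT /w mulmxA mulmxKtV // mxE rmorph_sum.
  by apply: eq_bigr => k _; rewrite !mxE -rmorphM.
rewrite -lecR rmorphM /= qE nE mulr_sumr.
by apply: ler_sum => k _; rewrite ler_wpM2r ?exprn_ge0.
Qed.

(* A maximiser of the Rayleigh quotient is a zero of the nonnegative quadratic
   form [lambda1 A * |x|^2 - qform A x], hence a critical point of it. *)
Lemma rayleigh_eq A x : (0 < n)%N -> A^T = A ->
  qform A x = lambda1 A * \sum_i x i ^+ 2 ->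
  forall i, \sum_j A i j * x j = lambda1 A * x i.
Proof.
move=> n0 symA qx i; set l := lambda1 A.
pose s := \sum_j A i j * x j; pose N := \sum_i x i ^+ 2.
pose e t : 'I_n -> R := fun j => x j + t * (j == i)%:R.
have delta (F : 'I_n -> R) : \sum_j F j * (j == i)%:R = F i.
  rewrite (bigD1 i) //= eqxx mulr1 big1 ?addr0 // => j /negPf ->.
  by rewrite mulr0.
have NE t : \sum_j e t j ^+ 2 = N + 2 * t * x i + t ^+ 2.
  rewrite -[x i]delta -[t ^+ 2](delta (fun=> t ^+ 2)) mulr_sumr -!big_split /=.
  apply: eq_bigr => j _; rewrite /e; case: (j == i); rewrite ?mulr1 ?mulr0; ring.
have qE t : qform A (e t) = qform A x + 2 * t * s + t ^+ 2 * A i i.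
  have -> : qform A (e t) =
      qform A x + (\sum_k (t * \sum_j A k j * x j) * (k == i)%:R +
      \sum_k \sum_j (t * A k j * x k) * (j == i)%:R) +
      \sum_k (\sum_j (t ^+ 2 * A k j) * (j == i)%:R) * (k == i)%:R.
    rewrite /qform -!big_split /=; apply: eq_bigr => k _.
    rewrite mulr_sumr !mulr_suml -!big_split /=; apply: eq_bigr => j _.
    by rewrite /e; ring.
  rewrite !delta; under [X in _ + (_ + X)]eq_bigr do rewrite delta.
  suff -> : \sum_k t * A k i * x k = t * s by rewrite -/s; ring.
  rewrite /s mulr_sumr; apply: eq_bigr => k _.
  by rewrite -[in LHS]symA mxE mulrA.
(* This is the Rayleigh bound at [e t]; the terms free of [t] cancel by [qx]. *)
have pos t : 2 * t * (s - l * x i) <= t ^+ 2 * (l - A i i).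
  have := rayleigh (e t) n0 symA; rewrite NE qE qx -/l -/N; lra.
rewrite -/s.
apply/eqP; rewrite -subr_eq0; set c := s - l * x i in pos *.
apply/negPn/negP => c0; set b := l - A i i in pos.
have b0 : 0 <= b by have := pos 1; have := pos (-1); lra.
have cp : 0 < c ^+ 2 by rewrite exprn_even_gt0.
have b1 : b + 1 != 0 by rewrite lt0r_neq0 // ltr_wpDl.
(* For [c != 0], this choice of [t] reduces the inequality to [2 * (b + 1) <= b], impossible for
   [b >= 0]. *)
clear qx NE qE; clearbody c b; have := pos (c / (b + 1)).
have -> : 2 * (c / (b + 1)) * c = c ^+ 2 * (2 / (b + 1)) by ring.
have -> : (c / (b + 1)) ^+ 2 * b = c ^+ 2 * (b / (b + 1) ^+ 2).
  by field.
rewrite ler_pM2l // ler_pdivlMr; last by rewrite exprn_gt0 //; lra.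
have -> : 2 / (b + 1) * (b + 1) ^+ 2 = 2 * (b + 1) by field.
lra.
Qed.

(** Since [A] has nonnegative entries, taking absolute values in an eigenvector for [lambda1 A]
    cannot lower the form; the result is a maximiser, hence again an eigenvector. *)
Lemma perron A : (0 < n)%N -> A^T = A -> (forall i j, (i != j)%:R <= A i j) ->
  exists x, [/\ forall i, 0 < x i,
    qform A x = lambda1 A * \sum_i x i ^+ 2 &
    forall i, \sum_j A i j * x j = lambda1 A * x i].
Proof.
move=> n0 symA A1; have [/eigenvalueP[v vA v0] _] := lambda1P n0 symA.
have A0 i j : 0 <= A i j by apply: le_trans (A1 i j).
pose x i := `|v 0 i|.
have Sx : \sum_i x i ^+ 2 = \sum_i v 0 i ^+ 2.
  by apply: eq_bigr => i _; rewrite /x real_normK ?num_real.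
have qv : qform A (v 0) = lambda1 A * \sum_i v 0 i ^+ 2.
  rewrite /qform exchange_big mulr_sumr /=; apply: eq_bigr => j _.
  rewrite -mulr_suml expr2 mulrA; congr (_ * _).
  have /rowP/(_ j) := vA; rewrite !mxE => <-.
  by apply: eq_bigr => i _; rewrite mulrC.
have qx : qform A x = lambda1 A * \sum_i x i ^+ 2.
  apply/le_anti; rewrite rayleigh // Sx -qv.
  apply: ler_sum => i _; apply: ler_sum => j _.
  by rewrite -!mulrA ler_wpM2l // /x -normrM ler_norm.
have ex := rayleigh_eq n0 symA qx.
exists x; split => //.
have x0 i : 0 <= x i by apply: normr_ge0.
have S0 : 0 < \sum_i x i.
  rewrite lt_neqAle sumr_ge0 // andbT eq_sym; apply: contra_neq v0.
  move/psumr_eq0P => z; apply/rowP => i; rewrite mxE.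
  by apply/normr0_eq0; apply: z.
(* Off-diagonal entries are at least 1, so a zero entry of [x] would force the whole sum to
   vanish. *)
have key i : \sum_j x j <= (lambda1 A + 1) * x i.
  rewrite mulrDl mul1r -ex -lerBlDr.
  rewrite -sum_neq.
  by apply: ler_sum => j _; rewrite ler_wpM2r.
move=> i; rewrite lt_neqAle x0 andbT eq_sym; apply/eqP => xi.
by have := key i; rewrite xi mulr0 leNgt S0.
Qed.

End Rayleigh.

(** * The forms of [J - I + A(G)] *)


Lemma tr_distmx (R : realType) n (G : sgraph n) : (distmx R G)^T = distmx R G.
Proof. by apply/matrixP => i j; rewrite !mxE dist_sym. Qed.

Section Forms.
Variables (R : realType) (n : nat) (G : sgraph n).
Implicit Types (x : 'I_n -> R) (s : nat -> 'I_n) (p : nat -> nat).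

Definition eform x : R := \sum_u \sum_v (G u v)%:R * x u * x v.

Definition nbsum x (u : 'I_n) : R := \sum_v (G u v)%:R * x v.

Lemma sum_sum_neq x : \sum_i \sum_j (i != j)%:R * x i * x j =
  (\sum_i x i) ^+ 2 - \sum_i x i ^+ 2.
Proof.
rewrite expr2 mulr_suml -sumrB; apply: eq_bigr => i _.
rewrite [x i ^+ 2]expr2 -mulrBr -sum_neq mulr_sumr; apply: eq_bigr => j _.
by rewrite mulrAC mulrC.
Qed.

Lemma qform_compl x : (1 < n)%N -> undominated G ->
  qform (distmx R (compl G)) x =
  (\sum_i x i) ^+ 2 - \sum_i x i ^+ 2 + eform x.
Proof.
move=> n1 und; rewrite -sum_sum_neq /eform -big_split; apply: eq_bigr => i _ /=.
rewrite -big_split; apply: eq_bigr => j _ /=.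
by rewrite mxE dist_compl // natrD !mulrDl.
Qed.

Lemma row_compl x i : (1 < n)%N -> undominated G ->
  \sum_j distmx R (compl G) i j * x j = \sum_j x j - x i + nbsum x i.
Proof.
move=> n1 und; rewrite -sum_neq /nbsum -big_split; apply: eq_bigr => j _ /=.
by rewrite mxE dist_compl // natrD mulrDl.
Qed.

Lemma distmx_compl_ge i j : (1 < n)%N -> (i != j)%:R <= distmx R (compl G) i j.
Proof.
move=> n1; rewrite mxE ler_nat; apply: leq_trans (dist_compl_ge G i j n1).
exact: leq_addr.
Qed.

Lemma sum_layout s p x : layout G s p -> \sum_v x v = \sum_(k < n) x (s k).
Proof.
case=> inj _ _; apply: (reindex (fun k : 'I_n => s k)).
apply/onW_bij/injF_bij => i j /inj e; apply/val_inj/e; by rewrite inE ltn_ord.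
Qed.

Lemma nbsum_layout s p x k : layout G s p -> (k < n)%N ->
  nbsum x (s k) = \sum_(j < n) (parent_adj p k j)%:R * x (s j).
Proof.
move=> ls kn; rewrite /nbsum (sum_layout _ ls); apply: eq_bigr => j _.
by rewrite (layout_adj ls).
Qed.

Lemma eform_layout s p x : layout G s p -> (0 < n)%N ->
  eform x = 2 * \sum_(1 <= j < n) x (s (p j)) * x (s j).
Proof.
move=> ls n0; rewrite /eform (sum_layout _ ls).
under eq_bigr do rewrite (sum_layout _ ls).
pose h i j := (parent_adj p i j)%:R * x (s i) * x (s j).
have -> : \sum_(i < n) \sum_(j < n) (G (s i) (s j))%:R * x (s i) * x (s j) =
    \sum_(i < n) \sum_(j < n) h i j.
  by apply: eq_bigr => i _; apply: eq_bigr => j _; rewrite (layout_adj ls).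
have [_ pj _] := ls.
(* Induction along the layout: vertex [m.+1] adds only the edge to its parent, counted in both
   directions. *)
suff H m : (m < n)%N -> \sum_(i < m.+1) \sum_(j < m.+1) h i j =
    2 * \sum_(1 <= j < m.+1) x (s (p j)) * x (s j).
  by have := H n.-1; rewrite prednK //; apply.
have hs i j : h i j = h j i.
  rewrite /h mulrAC; congr (_%:R * _ * _).
  by rewrite /parent_adj; case: ltngtP.
have h0 i : h i i = 0 by rewrite /h /parent_adj ltnn !mul0r.
elim: m => [_|m IH mn].
  by rewrite !big_ord_recl !big_ord0 big_nil h0 mulr0 !addr0.
rewrite big_ord_recr /= [in RHS]big_nat_recr //= mulrDr -IH ?(ltnW mn) //.
under eq_bigr do rewrite big_ord_recr.
rewrite big_split /= -addrA; congr (_ + _).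
rewrite [X in _ + X]big_ord_recr /= h0 addr0.
under [X in _ + X]eq_bigr do rewrite hs.
suff -> : \sum_(i < m.+1) h i m.+1 = x (s (p m.+1)) * x (s m.+1) by ring.
have pm : (p m.+1 < m.+1)%N by apply: pj.
rewrite (bigD1 (Ordinal pm)) //= big1 ?addr0 => [|i ni].
  by rewrite /h /parent_adj pm eqxx mul1r.
rewrite /h /parent_adj ltn_ord; case: eqP => [e|_]; last by rewrite !mul0r.
by move: ni; rewrite -val_eqE /= e eqxx.
Qed.

End Forms.

(** * Neighbour sums along the path listed from its centre *)

Definition ext0 (R : nmodType) (n : nat) (f : nat -> R) (k : nat) : R :=
  if (k < n)%N then f k else 0.

Lemma sum_pair (R : realType) n (f : nat -> R) a b : a != b ->
  \sum_(j < n) ((j == a :> nat) || (j == b :> nat))%:R * f j =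
  ext0 n f a + ext0 n f b.
Proof.
have one c : \sum_(j < n) (j == c :> nat)%:R * f j = ext0 n f c.
  rewrite /ext0; case: ltnP => cn.
    rewrite (bigD1 (Ordinal cn)) //= eqxx mul1r big1 ?addr0 // => j.
    by rewrite -val_eqE /= => /negPf ->; rewrite mul0r.
  rewrite big1 // => j _; case: eqP => [e|_]; last by rewrite mul0r.
  by move: (ltn_ord j); rewrite e ltnNge cn.
move=> ab; rewrite -!one -big_split; apply: eq_bigr => j _ /=.
rewrite -mulrDl -natrD; congr (_%:R * _).
case: (j =P a :> nat) => [->|_] //=; by rewrite (negPf ab).
Qed.

(** Positions 0 and 1 are central and adjacent, because [j.-2] is truncated at 0; from there on,
    position [k] has neighbours two places before and after. *)
Definition spread_nb (R : nmodType) (Y : nat -> R) (k : nat) : R :=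
  match k with
  | 0 => Y 1 + Y 2
  | 1 => Y 0 + Y 3
  | k'.+2 => Y k' + Y k'.+4
  end.

Lemma sum_spread (R : realType) n (f : nat -> R) k :
  \sum_(j < n) (parent_adj (fun j => j.-2) k j)%:R * f j =
  spread_nb (ext0 n f) k.
Proof.
have E a b : a != b ->
    (forall j, parent_adj (fun j => j.-2) k j = (j == a) || (j == b)) ->
    \sum_(j < n) (parent_adj (fun j => j.-2) k j)%:R * f j =
    ext0 n f a + ext0 n f b.
  by move=> ab kE; under eq_bigr do rewrite kE; apply: sum_pair.
by case: k E => [|[|k]] E; apply: E => [|j]; rewrite /parent_adj; try case: ifP; lia.
Qed.

(* Minimum principle for the differences [Y k - Y k.+1]: at a negative minimum
   the equations would bound [m] by 2. *)
Lemma spread_decreasing (R : realType) n (m S : R) (Y : nat -> R) : 2 < m ->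
  (forall k, (n <= k)%N -> Y k = 0) -> (forall k, 0 <= Y k) ->
  (forall k, (k < n)%N -> m * Y k = S + spread_nb Y k) ->
  forall k, Y k.+1 <= Y k.
Proof.
move=> m2 Yn Y0 eqY k; pose f k := Y k - Y k.+1.
suff: 0 <= f k by rewrite subr_ge0.
have fn j : (n <= j.+1)%N -> 0 <= f j by move=> nj; rewrite /f (Yn j.+1) // subr0.
have [/fn//|kn] := leqP n k.+1; rewrite leNgt; apply/negP => fk.
have kn' : (k < n)%N by apply: ltnW.
case: (arg_minP (P := xpredT) (fun i : 'I_n => f i) (i0 := Ordinal kn'))
  => // i _ imin.
have fi : f i < 0 by apply: le_lt_trans fk; apply: (imin (Ordinal kn')).
have fmin j : f i <= f j.
  have [jn|nj] := ltnP j n; first exact: (imin (Ordinal jn)).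
  by apply: le_trans (ltW fi) (fn _ _); apply: leqW.
have iS : (i.+1 < n)%N.
  by rewrite ltnNge; apply/negP => /fn; rewrite leNgt fi.
have e1 := eqY _ (ltn_ord i); have e2 := eqY _ iS; move: fi fmin e1 e2.
(* Subtracting the equations at [i] and [i.+1] gives [m * f i] as [f 2 - f 0], [f 3] or
   [f j + f j.+4]. Each is at least [2 * f i], against [2 < m] and [f i < 0]. *)
case: (nat_of_ord i) => [|[|j]] fi fmin /= e1 e2.
- by have := fmin 2%N; move: fi; rewrite /f; nra.
- by have := fmin 3%N; move: fi; rewrite /f; nra.
- by have := fmin j; have := fmin j.+4; move: fi; rewrite /f; nra.
Qed.

(** * Comparison *)

(* Locked: otherwise unification unfolds [lambda1] down to the reals. *)
HB.lock Definition lambda1_compl (R : realType) (n : nat) (G : sgraph n) : R :=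
  lambda1 (distmx R (compl G)).

Lemma lambda1_complE (R : realType) n (G : sgraph n) :
  lambda1 (distmx R (compl G)) = lambda1_compl R G.
Proof. by rewrite lambda1_compl.unlock. Qed.

Section Bounds.
Variables (R : realType) (n : nat).
Hypothesis n5 : (4 < n)%N.
Implicit Types (G H T : sgraph n) (x : 'I_n -> R).

Let n0 : (0 < n)%N. Proof. exact: leq_trans n5. Qed.
Let n1 : (1 < n)%N. Proof. exact: leq_trans n5. Qed.

Local Notation D G := (distmx R (compl G)).
Local Notation lam G := (lambda1_compl R G).

Lemma sum_sqr_gt0 x : (forall i, 0 < x i) -> 0 < \sum_i x i ^+ 2.
Proof.
move=> x0; rewrite (bigD1 (Ordinal n0)) //= ltr_wpDr ?exprn_gt0 //.
by apply: sumr_ge0 => i _; rewrite sqr_ge0.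
Qed.

Lemma compl_perron G : exists x, [/\ forall i, 0 < x i,
  qform (D G) x = lam G * \sum_i x i ^+ 2 &
  forall i, \sum_j D G i j * x j = lam G * x i].
Proof.
rewrite -lambda1_complE; apply: perron => // [|i j]; first exact: tr_distmx.
exact: distmx_compl_ge.
Qed.

Lemma compl_rayleigh G x : qform (D G) x <= lam G * \sum_i x i ^+ 2.
Proof. by rewrite -lambda1_complE; apply: rayleigh n0 (tr_distmx _ _). Qed.

Lemma compl_rayleigh_eq G x : qform (D G) x = lam G * \sum_i x i ^+ 2 ->
  forall i, \sum_j D G i j * x j = lam G * x i.
Proof. by rewrite -lambda1_complE; apply: rayleigh_eq n0 (tr_distmx _ _). Qed.

(** One inequality suffices, since for the path the reverse one is [path_lambda1_le]. *)
Lemma iso_lambda1_le G H : undominated G -> undominated H -> iso G H ->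
  lam G <= lam H.
Proof.
move=> uG uH [f fB fE]; have [x [x0 qx _]] := compl_perron G.
have [g fK gK] := fB; have gB : bijective g by exists f.
rewrite -(ler_pM2r (sum_sqr_gt0 x0)) -qx.
have reg (F : 'I_n -> R) : \sum_i F i = \sum_i F (g i).
  by apply: reindex; apply: onW_bij.
have -> : \sum_i x i ^+ 2 = \sum_i (x \o g) i ^+ 2 by rewrite reg.
suff -> : qform (D G) x = qform (D H) (x \o g) by apply: compl_rayleigh.
rewrite !qform_compl // (reg x) (reg (fun i => x i ^+ 2)); congr (_ + _).
rewrite /eform reg; apply: eq_bigr => u _; rewrite reg; apply: eq_bigr => v _.
by rewrite -fE !gK.
Qed.

Lemma path_perron : exists s x,
  [/\ layout (path_graph n) s (fun j => j.-2), forall i, 0 < x i,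
    qform (D (path_graph n)) x = lam (path_graph n) * \sum_i x i ^+ 2,
    forall i, \sum_j D (path_graph n) i j * x j = lam (path_graph n) * x i &
    forall i j, (i <= j < n)%N -> x (s j) <= x (s i)].
Proof.
have [s ls] := path_layout n0.
have [x [x0 qx ex]] := compl_perron (path_graph n).
exists s, x; split=> //.
have uP := path_undominated n5; set l := lam _ in ex *.
set S := \sum_j x j.
have S0 : 0 < S.
  rewrite /S (bigD1 (Ordinal n0)) //= ltr_wpDr //.
  by apply: sumr_ge0 => i _; apply: ltW.
have nb0 i : 0 <= nbsum (path_graph n) x i.
  by apply: sumr_ge0 => j _; rewrite mulr_ge0 // ltW.
have row i : (l + 1) * x i = S + nbsum (path_graph n) x i.
  by rewrite mulrDl -ex row_compl // -/S; ring.
(* Neighbour sums are nonnegative, so adding up all rows gives [S * n%:R <= (l + 1) * S]. *)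
have l2 : 2 < l + 1.
  have : S * n%:R <= (l + 1) * S.
    rewrite [X in _ <= _ * X](_ : S = \sum_j x j) // mulr_sumr mulr_natr.
    have -> : S *+ n = \sum_(i < n) S by rewrite sumr_const card_ord.
    apply: ler_sum => i _.
    by rewrite row lerDl.
  rewrite mulrC ler_pM2r //; apply: lt_le_trans.
  by rewrite ltr_nat; lia.
pose Y := ext0 n (fun k => x (s k)).
have dec : forall k, Y k.+1 <= Y k.
  apply: (spread_decreasing (n := n) (m := l + 1) (S := S)) => // k.
  - by rewrite /Y /ext0 ltnNge => ->.
  - by rewrite /Y /ext0; case: ifP => // _; apply: ltW.
  - by move=> kn; rewrite -sum_spread {1}/Y /ext0 kn row (nbsum_layout _ ls).
move=> i j /andP[ij jn]; have -> : x (s j) = Y j by rewrite /Y /ext0 jn.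
have -> : x (s i) = Y i by rewrite /Y /ext0 (leq_ltn_trans ij jn).
elim: j ij {jn} => [|j IH]; first by rewrite leqn0 => /eqP ->.
rewrite leq_eqVlt => /predU1P[->//|]; rewrite ltnS => /IH.
exact: le_trans (dec j).
Qed.

(* A first [k] with [p k < k.-2] would give the vertex [p k] all its neighbours
   in the path together with the extra neighbour [k]. *)
Lemma parent_spread (p : nat -> nat) (y : nat -> R) :
  (forall k, (k < n)%N -> 0 < y k) ->
  (forall j, (0 < j < n)%N -> (p j <= j.-2)%N) ->
  (forall v, (v < n)%N ->
    \sum_(j < n) (parent_adj p v j)%:R * y j =
    \sum_(j < n) (parent_adj (fun j => j.-2) v j)%:R * y j) ->
  forall j, (0 < j < n)%N -> p j = j.-2.
Proof.
move=> y0 pj eqn; elim/ltn_ind => k IH /andP[k0 kn].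
apply/eqP; apply/negPn/negP => pk.
have pk2 : (p k < k.-2)%N by have := pj k; lia.
have vn : (p k < n)%N by lia.
suff : \sum_(j < n) (parent_adj (fun j => j.-2) (p k) j)%:R * y j <
       \sum_(j < n) (parent_adj p (p k) j)%:R * y j by rewrite eqn // ltxx.
rewrite (bigD1 (Ordinal kn)) //= [ltRHS](bigD1 (Ordinal kn)) //=.
apply: ltr_leD.
  have -> : parent_adj (fun j => j.-2) (p k) k = false.
    by rewrite /parent_adj; case: ifP; lia.
  have -> : parent_adj p (p k) k by rewrite /parent_adj; case: ifP; lia.
  by rewrite mul0r mul1r y0.
apply: ler_sum => j _; rewrite ler_wpM2r ?(ltW (y0 _ _)) // ler_nat.
(* The path neighbours of [p k], and [p k] itself, precede [k], where [p] already agrees with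
   [j.-2]. *)
suff : parent_adj (fun j => j.-2) (p k) j -> parent_adj p (p k) j.
  by case: (parent_adj _ _ _) => // ->.
rewrite /parent_adj; case: ltngtP => //= h.
  by move=> e; rewrite (IH j) //; lia.
by move=> e; rewrite (IH (p k)) //; lia.
Qed.

Lemma path_lambda1_le T : is_tree T -> undominated T ->
  lam (path_graph n) <= lam T /\
  (lam (path_graph n) = lam T -> iso T (path_graph n)).
Proof.
move=> tT uT; have uP := path_undominated n5.
have [s [x [ls x0 qx ex dec]]] := path_perron.
have [sT [p [lsT pj]]] := tree_layout_spread n1 tT.
have [t [tn tK sTK]] := layout_inv lsT.
pose z v := x (s (t v)).
have zE k : (k < n)%N -> z (sT k) = x (s k) by move=> kn; rewrite /z sTK.
have sumE (F : R -> R) : \sum_i F (z i) = \sum_i F (x i).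
  rewrite (sum_layout _ lsT) (sum_layout _ ls).
  by apply: eq_bigr => k _; rewrite zE.
have eE : eform T z = 2 * \sum_(1 <= j < n) x (s (p j)) * x (s j).
  rewrite (eform_layout _ lsT) //; congr (_ * _); rewrite !big_nat.
  apply: eq_bigr => j jn; have [_ /(_ j jn) pjj _] := lsT.
  by rewrite !zE //; lia.
have le_e : eform (path_graph n) x <= eform T z.
  rewrite eE (eform_layout _ ls) // ler_wpM2l // !big_nat.
  apply: ler_sum => j jn; rewrite ler_wpM2r ?(ltW (x0 _)) // dec //.
  by have := pj j jn; lia.
have le_q : qform (D (path_graph n)) x <= qform (D T) z.
  rewrite !qform_compl // (sumE id) (sumE (fun u => u ^+ 2)).
  by rewrite lerD2l.
have ray := compl_rayleigh T z.
rewrite (sumE (fun u => u ^+ 2)) in ray.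
split; first by rewrite -(ler_pM2r (sum_sqr_gt0 x0)) -qx (le_trans le_q ray).
(* Equal eigenvalues make [z] a maximiser for [T], hence an eigenvector; comparing rows then leaves
   equal neighbour sums. *)
move=> lPT; have qz : qform (D T) z = lam T * \sum_i z i ^+ 2.
  rewrite (sumE (fun u => u ^+ 2)); apply/le_anti; rewrite ray /=.
  by rewrite -lPT -qx.
have ez := compl_rayleigh_eq qz.
have pE : forall j, (0 < j < n)%N -> p j = j.-2.
  apply: (@parent_spread _ (fun k => x (s k))) => // v vn.
  have := ez (sT v); rewrite (row_compl _ _ n1 uT) -lPT zE // -ex.
  rewrite (row_compl _ _ n1 uP).
  rewrite (sumE id) => /addrI.
  rewrite (nbsum_layout _ lsT vn) (nbsum_layout _ ls vn) => <-.
  by apply: eq_bigr => j _; rewrite zE.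
by apply: (layout_iso lsT ls) => j /pE.
Qed.

(** The left side is the form of [J - I + A] for the star centred at [a]. The broom trades the edge
    [ac] for [bc], but gains the extra weight of the pair [ab]. *)
Lemma qform_broom x (a b c : 'I_n) : a = 0%N :> nat -> b = 1%N :> nat ->
  c = 2%N :> nat -> (forall i, 0 < x i) -> x c <= x b ->
  (\sum_i x i) ^+ 2 - \sum_i x i ^+ 2 + 2 * x a * (\sum_i x i - x a)
    < qform (D (broom n)) x.
Proof.
move=> a0 b1 c2 x0 xcb.
pose B i j : R := (i != j)%:R + (broom n i j)%:R +
  ((i < 2)%N && (j < 2)%N && (i != j))%:R.
have leB : \sum_i \sum_j B i j * x i * x j <= qform (D (broom n)) x.
  apply: ler_sum => i _; apply: ler_sum => j _.
  rewrite !ler_wpM2r ?(ltW (x0 _)) // mxE /B -!natrD ler_nat.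
  exact: dist_broom_compl.
apply: lt_le_trans leB.
have -> : \sum_i \sum_j B i j * x i * x j =
    (\sum_i x i) ^+ 2 - \sum_i x i ^+ 2 + eform (broom n) x +
    \sum_(i < n) \sum_(j < n) ((i < 2)%N && (j < 2)%N && (i != j))%:R * x i * x j.
  rewrite -sum_sum_neq /eform -!big_split /=; apply: eq_bigr => i _.
  by rewrite -!big_split; apply: eq_bigr => j _; rewrite /B /=; ring.
have -> : \sum_(i < n) \sum_(j < n)
    ((i < 2)%N && (j < 2)%N && (i != j))%:R * x i * x j = 2 * x a * x b.
  have ab : a != b by rewrite -val_eqE /= a0 b1.
  have small (i : 'I_n) : (i < 2)%N = (i == a) || (i == b).
    by rewrite -!val_eqE /= a0 b1; lia.
  have pick2 (F : 'I_n -> R) : (forall i, i != a -> i != b -> F i = 0) ->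
      \sum_i F i = F a + F b.
    move=> F0; rewrite (bigD1 a) //= (bigD1 b) 1?eq_sym //= big1 ?addr0 //.
    by move=> i /andP[ia ib]; apply: F0.
  rewrite pick2 => [|i /negPf ia /negPf ib]; last first.
    by apply: big1 => j _; rewrite small ia ib !mul0r.
  rewrite !pick2 => [|i /negPf ia /negPf ib|i /negPf ia /negPf ib].
  - rewrite !small !eqxx /= (eq_sym b a) ab !orbT /=; ring.
  - by rewrite [(i < 2)%N]small ia ib andbF !mul0r.
  - by rewrite [(i < 2)%N]small ia ib andbF !mul0r.
rewrite -[ltRHS]addrA ltrD2l.
pose o : nat -> 'I_n := insubd (Ordinal n0).
have oE (i : 'I_n) : o i = i by apply: val_inj; rewrite val_insubd ltn_ord.
have lB := broom_layout n0; rewrite (eform_layout _ lB) // -/o.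
have S1 : \sum_i x i - x a = \sum_(1 <= j < n) x (o j).
  rewrite (sum_layout _ lB) -(big_mkord xpredT (fun k => x (o k))).
  by rewrite big_ltn // -a0 oE addrC addKr.
have split2 (F : nat -> R) :
    \sum_(1 <= j < n) F j = F 1%N + F 2%N + \sum_(3 <= j < n) F j.
  by rewrite big_ltn // big_ltn 1?addrA //; lia.
have o0 : o 0%N = a by rewrite -a0 oE.
have o1 : o 1%N = b by rewrite -b1 oE.
have o2 : o 2%N = c by rewrite -c2 oE.
rewrite S1 !split2 /= o0 o1 o2.
have -> : \sum_(3 <= j < n) x (o (j == 2)%N) * x (o j) =
    x a * \sum_(3 <= j < n) x (o j).
  rewrite mulr_sumr !big_nat; apply: eq_bigr => j j3.
  by have -> : (j == 2)%N = false by [lia]; rewrite /= o0.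
(* The difference of the two sides is [2 * (x b * x c + x a * (x b - x c))]. *)
by have := x0 a; have := x0 b; have := x0 c; nra.
Qed.

Lemma broom_lambda1_gt T : is_tree T -> undominated T -> lam T < lam (broom n).
Proof.
move=> tT uT; have [x [x0 qx _]] := compl_perron T.
have n2 : (2 < n)%N by apply: leq_trans n5.
pose a := Ordinal n0; pose b := Ordinal n1; pose c := Ordinal n2.
case: (arg_maxP (P := xpredT) x (i0 := a)) => // r _ rmax.
have [s [p [ls s0]]] := tree_layout_root r tT.
have le_e : eform T x <= 2 * x r * (\sum_i x i - x r).
  rewrite (eform_layout _ ls) // -mulrA ler_wpM2l //.
  rewrite (sum_layout _ ls) -(big_mkord xpredT (fun k => x (s k))).
  rewrite big_ltn // s0 addrAC subrr add0r mulr_sumr.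
  by apply: ler_sum => j _; rewrite ler_wpM2r ?(ltW (x0 _)) //; apply: rmax.
(* The permutation brings the maximal entry to vertex 0 of the broom and orders the entries at 1 and
   2, swapping them if necessary. *)
have [f fa fcb] : exists2 f : {perm 'I_n}, f a = r & x (f c) <= x (f b).
  have [h|h] := leP (x (tperm a r c)) (x (tperm a r b)).
    by exists (tperm a r) => //; rewrite tpermL.
  exists (tperm b c * tperm a r)%g; rewrite !permM.
    by rewrite (@tpermD _ b c a) // tpermL.
  by rewrite tpermL tpermR ltW.
pose z i := x (f i).
have reg (F : R -> R) : \sum_i F (x i) = \sum_i F (z i).
  by rewrite (reindex_inj (@perm_inj _ f)).
rewrite -(ltr_pM2r (sum_sqr_gt0 x0)) -qx (reg (fun u => u ^+ 2)).
apply: lt_le_trans (compl_rayleigh _ z).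
have := @qform_broom z a b c erefl erefl erefl (fun i => x0 _) fcb.
apply: le_lt_trans; rewrite qform_compl // -(reg id) -(reg (fun u => u ^+ 2)).
by rewrite lerD2l /z fa.
Qed.

End Bounds.

Theorem theorem4p6 (R : realType) (n : nat) (T : sgraph n)
    (treeT : is_tree T) (diamT : (3 < diameter T)%N) :
  let lamP := lambda1 (distmx R (compl (path_graph n))) in
  let lamT := lambda1 (distmx R (compl T)) in
  let lamB := lambda1 (distmx R (compl (broom n))) in
  [/\ lamP <= lamT,
      lamT <= lamB,
      (lamP = lamT <-> iso T (path_graph n)) &
      (lamT = lamB <-> iso T (broom n))].
Proof.
move=> lamP lamT lamB; rewrite /lamP /lamT /lamB !lambda1_complE.
have n5 : (4 < n)%N := diameter_lt_order treeT.1 diamT.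
have uT := diameter_undominated diamT; have uP := path_undominated n5.
have [lePT eqPT] := path_lambda1_le R n5 treeT uT.
have ltTB := broom_lambda1_gt R n5 treeT uT.
split.
- exact: lePT.
- exact: ltW.
- split=> [|TP]; first exact: eqPT.
  by apply: le_anti; rewrite lePT (iso_lambda1_le R n5 uT uP TP).
(* Both sides are false: the inequality is strict, and an isomorphism would make the broom
   [undominated]. *)
- split=> [e|TB]; first by move: ltTB; rewrite e ltxx.
  by case: (broom_dominated n5); apply: undominated_iso TB uT.
Qed.
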